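(* Let $\mathcal{P}_0$ denote the set of distributions of pairs $(X,\Omega)$ on $\mathcal{X} \times \{0,1\}^d$ under which $X$ and $\Omega$ are independent, and let $\mathcal{P}_0'$ denote the set of distributions on $\mathcal{X} \times \{0,1\}^d$ for which the corresponding sequence of conditional distributions $P_{\mathbb{S}} = (P_S : S \in \mathbb{S})$ is compatible. Then $\mathcal{P}_0 \subseteq \mathcal{P}_0'$, but for every $n \in \mathbb{N}$ and every (randomised) test $\psi \in \Psi$, \[ \sup_{P \in \mathcal{P}_0'} \mathbb{E}_P\,\psi(X_1 \circ \Omega_1,\ldots,X_n \circ \Omega_n) = \sup_{P \in \mathcal{P}_0} \mathbb{E}_P\,\psi(X_1 \circ \Omega_1,\ldots,X_n \circ \Omega_n), \] where under $\mathbb{E}_P$ the pairs $(X_1,\Omega_1),\ldots,(X_n,\Omega_n)$ are independent with common distribution $P$.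
   Context: Let $d \in \mathbb{N}$, $[d] := \{1,\ldots,d\}$, let $(\mathcal{X}_j,\mathcal{A}_j)$, $j \in [d]$, be measurable topological spaces, $\mathcal{X} := \prod_{j=1}^d \mathcal{X}_j$, and for $S \subseteq [d]$ let $\mathcal{X}_S := \prod_{j\in S}\mathcal{X}_j$ (a one-point space if $S=\emptyset$) and $x_S := (x_j : j \in S)$ for $x \in \mathcal{X}$. For $x \in \mathcal{X}$ and $\omega \in \{0,1\}^d$, $x \circ \omega$ is the element of $\prod_{j=1}^d (\mathcal{X}_j \cup \{\star\})$ whose $j$th entry is $x_j$ if $\omega_j = 1$ and is $\star$ (a symbol denoting a missing value) if $\omega_j = 0$. $\Psi$ is the set of Borel measurable functions $\psi: \bigl(\prod_{j=1}^d (\mathcal{X}_j \cup \{\star\})\bigr)^n \to [0,1]$. For $S \subseteq [d]$ write $\mathbb{1}_S \in \{0,1\}^d$ for the indicator vector of $S$. Given a distribution $P$ of $(X,\Omega)$ on $\mathcal{X}\times\{0,1\}^d$, set $\mathbb{S} := \{S \subseteq [d] : \mathbb{P}(\Omega = \mathbb{1}_S) > 0\}$ and, for $S \in \mathbb{S}$, let $P_S$ be the conditional distribution of $X_S$ given $\Omega = \mathbb{1}_S$; $P_{\mathbb{S}} := (P_S : S \in \mathbb{S})$ is the corresponding sequence of conditional distributions. A sequence $P_{\mathbb{S}}$ is called compatible if there exists a probability distribution on $\mathcal{X}$ whose marginal on $\mathcal{X}_S$ is $P_S$ for every $S \in \mathbb{S}$. *)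

(* Defs.v *)
From HB Require Import structures.
From mathcomp Require Import all_boot all_order all_algebra.
From mathcomp Require Import all_classical all_reals all_analysis.

Set Implicit Arguments.
Unset Strict Implicit.
Unset Printing Implicit Defensive.

Import Order.TTheory GRing.Theory Num.Theory.

Local Open Scope classical_set_scope.
Local Open Scope ring_scope.

(* No compatibility between the topology and the sigma-algebra is imposed; the
   case where the sigma-algebra is the Borel one is an instance. *)
#[short(type="measurableTopologicalType")]
HB.structure Definition MeasurableTopological d :=
  {T of Topological T & Measurable d T}.

Section product_space.

Definition measure_mprod_display (I : Type) (disp : I -> measure_display) :
  measure_display.
Proof. exact: default_measure_display. Qed.

Context (I : Type) (disp : I -> measure_display).

(* [mprod T] carries the product sigma-algebra of the [T i], which in general is
   smaller than the Borel sigma-algebra of the product topology. *)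
Definition mprod (T : forall i, measurableType (disp i)) : Type :=
  forall i, T i.

Variable T : forall i, measurableType (disp i).

HB.instance Definition _ := Pointed.copy (mprod T) (forall i, T i).

Definition mprod_cylinders : set (set (mprod T)) :=
  \bigcup_i preimage_set_system setT (fun x : mprod T => x i) measurable.

Let mprod_set0 : <<s mprod_cylinders >> set0.
Proof. exact: sigma_algebra0. Qed.

Let mprod_setC A : <<s mprod_cylinders >> A -> <<s mprod_cylinders >> (~` A).
Proof. exact: sigma_algebraC. Qed.

Let mprod_bigcup (F : (set (mprod T))^nat) :
  (forall k, <<s mprod_cylinders >> (F k)) ->
  <<s mprod_cylinders >> (\bigcup_k F k).
Proof. exact: sigma_algebra_bigcup. Qed.

HB.instance Definition _ := @isMeasurable.Build (measure_mprod_display disp)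
  (mprod T) <<s mprod_cylinders >> mprod_set0 mprod_setC mprod_bigcup.

Lemma measurable_coord i : measurable_fun setT (fun x : mprod T => x i).
Proof.
move=> _ A mA; rewrite setTI; apply: sub_sigma_algebra.
by exists i => //; exists A => //; rewrite setTI.
Qed.

Lemma measurable_fun_mprodP d' (T' : measurableType d') (f : T' -> mprod T) :
  measurable_fun setT f <-> forall i, measurable_fun setT (fun x => f x i).
Proof.
split=> [mf i|mf].
  apply: (measurableT_comp (f := fun x : mprod T => x i)) mf.
  exact: measurable_coord.
move=> _ A mA; apply: (mA (image_set_system setT f measurable)).
split; first by apply: sigma_algebra_image; exact: sigma_algebra_measurable.
move=> _ [i _ [B mB <-]]; rewrite /image_set_system/= setTI.
exact: mf.
Qed.

End product_space.

Section option_measurable.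
Context d (T : measurableType d).

Let measurable_opt : set (set (option T)) :=
  [set A | measurable (Some @^-1` A)].

Let opt0 : measurable_opt set0.
Proof. by rewrite /measurable_opt/= preimage_set0. Qed.

Let optC A : measurable_opt A -> measurable_opt (~` A).
Proof.
move=> mA; rewrite /measurable_opt/= -preimage_setC; exact: (measurableC mA).
Qed.

Let opt_bigcup (F : (set (option T))^nat) :
  (forall k, measurable_opt (F k)) -> measurable_opt (\bigcup_k F k).
Proof.
move=> mF; rewrite /measurable_opt/= preimage_bigcup.
by apply: bigcup_measurable => k _; exact: mF.
Qed.

(* [None] plays the role of the missing value: this is the sigma-algebra of the
   disjoint union of [T] and a point. *)
HB.instance Definition _ := @isMeasurable.Build d (option T)
  measurable_opt opt0 optC opt_bigcup.

Lemma measurable_Some : measurable_fun setT (@Some T).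
Proof. by move=> _ A mA; rewrite setTI. Qed.

End option_measurable.

Section missing_data.
Context (R : realType) (d : nat) (disp : 'I_d -> measure_display).
Variable X : forall j : 'I_d, measurableType (disp j).

Definition cube := mprod (fun _ : 'I_d => bool : measurableType _).

Definition indic_vec (S : {set 'I_d}) : cube := fun j => j \in S.

Definition subspace_prod (S : {set 'I_d}) :=
  mprod (fun j : {j : 'I_d | j \in S} => X (val j)).

Definition restr (S : {set 'I_d}) (x : mprod X) : subspace_prod S :=
  fun j => x (val j).
Arguments restr S x : clear implicits.

Definition partial_space := mprod (fun j => option (X j) : measurableType _).

Definition mask (xw : mprod X * cube) : partial_space :=
  fun j => if xw.2 j then Some (xw.1 j) else None.

Definition pattern_event (S : {set 'I_d}) : set (mprod X * cube) :=
  [set xw | xw.2 = indic_vec S].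

Lemma measurable_fst_coord j :
  measurable_fun setT (fun xw : mprod X * cube => xw.1 j).
Proof. by move: j; apply/measurable_fun_mprodP; exact: measurable_fst. Qed.

Lemma measurable_snd_coord j :
  measurable_fun setT (fun xw : mprod X * cube => xw.2 j).
Proof.
move: j; apply/(measurable_fun_mprodP (T := fun=> bool)).
exact: measurable_snd.
Qed.

Lemma measurable_pattern_event S : measurable (pattern_event S).
Proof.
rewrite (_ : pattern_event S =
    \bigcap_(j in [set: 'I_d]) [set xw | xw.2 j = (j \in S)]).
  apply: fin_bigcap_measurable => // j _.
  have := @measurable_snd_coord j measurableT [set j \in S] I.
  by rewrite setTI.
apply/seteqP; split=> [xw h j _|xw h] /=.
  by rewrite [xw.2]h.
by apply: funext => j; exact: h.
Qed.

Definition restr_fst (S : {set 'I_d}) (xw : mprod X * cube) : subspace_prod S :=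
  restr S xw.1.
Arguments restr_fst : clear implicits.

Lemma measurable_restr_fst S : measurable_fun setT (restr_fst S).
Proof.
apply/(measurable_fun_mprodP (T := fun j => X (val j))) => j.
exact: measurable_fst_coord.
Qed.

HB.instance Definition _ S := isMeasurableFun.Build _ _ _ _
  (restr_fst S) (@measurable_restr_fst S).

Lemma measurable_mask : measurable_fun setT mask.
Proof.
apply/(measurable_fun_mprodP (T := fun j => option (X j))) => j.
apply: measurable_fun_if => //.
- exact: measurable_snd_coord.
- apply: measurable_funTS; apply: (measurableT_comp (@measurable_Some _ _)).
  exact: measurable_fst_coord.
Qed.

Implicit Types P : probability (mprod X * cube)%type R.

Definition patterns P : set {set 'I_d} :=
  [set S | (0 < P (pattern_event S))%E].

(* The default measure [P] in [mnormalize] is only used when [S] is not one of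
   the patterns of [P]. *)
Definition cond_law P (S : {set 'I_d}) : probability (subspace_prod S) R :=
  distribution (mnormalize (mrestr P (measurable_pattern_event S)) P)
    (restr_fst S).

Lemma cond_lawE P S (B : set (subspace_prod S)) : patterns P S ->
  cond_law P S B =
  (P [set xw | B (restr S xw.1) /\ xw.2 = indic_vec S] *
   (fine (P (pattern_event S)))^-1%:E)%E.
Proof.
move=> PS; rewrite /cond_law /distribution /pushforward.
rewrite /= /mnormalize /= /mrestr /= !setTI gt_eqF//= ifF//.
apply/negbTE; rewrite -ltey -ge0_fin_numE//.
by rewrite fin_num_measure//; exact: measurable_pattern_event.
Qed.

Definition compatible (SS : set {set 'I_d})
    (PS : forall S, SS S -> probability (subspace_prod S) R) : Prop :=
  exists Q : probability (mprod X) R, forall S (hS : SS S) B,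
    measurable B -> pushforward Q (restr S) B = PS S hS B.

Definition independent_laws : set (probability (mprod X * cube)%type R) :=
  [set P | forall A B, measurable A -> measurable B ->
    P (A `*` B) = (P (fst @^-1` A) * P (snd @^-1` B))%E].

Definition compatible_laws : set (probability (mprod X * cube)%type R) :=
  [set P | compatible (fun S (_ : patterns P S) => cond_law P S)].

Definition tests (n : nat) : set (n.-tuple partial_space -> R) :=
  [set psi : n.-tuple partial_space -> R |
    measurable_fun setT psi /\ forall z, 0 <= psi z <= 1].

End missing_data.

Arguments indic_vec {d} S _.
Arguments restr {d disp X} S x.
Arguments restr_fst {d disp X} S xw.
Arguments mask {d disp X} xw _.
Arguments independent_laws R {d disp} X.
Arguments compatible_laws R {d disp} X.
Arguments tests R {d disp} X n.

Section iid.
Context (R : realType) (d : measure_display) (T : measurableType d).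
Variable P : probability T R.

Definition cons_pair n (x : T * n.-tuple T) : n.+1.-tuple T :=
  [tuple of x.1 :: x.2].

Lemma measurable_cons_pair n : measurable_fun setT (@cons_pair n).
Proof. by apply: measurable_cons. Qed.

HB.instance Definition _ n := isMeasurableFun.Build _ _ _ _
  (@cons_pair n) (@measurable_cons_pair n).

(* Joint law of [n] independent draws from [P]. *)
Fixpoint iid_law (n : nat) : probability (n.-tuple T) R :=
  if n is m.+1 then distribution (P \x iid_law m)%E (@cons_pair m)
  else \d_[tuple].

Lemma iid_lawE n (A : 'I_n -> set T) : (forall i, measurable (A i)) ->
  iid_law n [set z | forall i, A i (tnth z i)] = (\prod_(i < n) P (A i))%E.
Proof.
elim: n A => [|n IH] A mA.
  by rewrite big_ord0 /= diracE mem_set// => -[].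
rewrite big_ord_recl -IH//= /distribution /pushforward /=.
rewrite -product_measure1E//; last first.
  rewrite (_ : [set _ | _] =
      \bigcap_(i in [set: 'I_n]) [set z | A (lift ord0 i) (tnth z i)]).
    apply: fin_bigcap_measurable => // i _.
    have := @measurable_tnth _ T n i measurableT _ (mA (lift ord0 i)).
    by rewrite setTI.
  by apply/seteqP; split=> [z h i _|z h i] /=; exact: h.
congr ((P \x iid_law n)%E _).
apply/seteqP; split=> [[x z] h|[x z] [/= hx hz] i] /=.
  split; first by have := h ord0.
  by move=> i; have := h (lift ord0 i); rewrite /= tnthS.
by case: (unliftP ord0 i) => [j ->|->]//; rewrite /= tnthS.
Qed.

End iid.

Section power.
Context (R : realType) (d : nat) (disp : 'I_d -> measure_display).
Variable X : forall j : 'I_d, measurableType (disp j).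

Definition mean_test n (psi : n.-tuple (partial_space X) -> R)
    (P : probability (mprod X * cube d)%type R) : \bar R :=
  ('E_(iid_law P n)[fun z => psi (map_tuple mask z)])%E.

End power.

(* Main.v *)
Require Import Defs.
From HB Require Import structures.
From mathcomp Require Import all_boot all_order all_algebra.
From mathcomp Require Import all_classical all_reals all_analysis.
From mathcomp Require measurable_realfun.

Import Order.TTheory GRing.Theory Num.Theory.

(** A test only sees the masked observations [mask (x, w)], so its mean depends
on the law [P] of [(X, Omega)] only through the image of [P] under [mask]
([mean_test_mask_law]). That image carries little information: on the event
where the pattern is [S], the masked vector is a function of [x_S], hence the
image is determined by the probabilities of the patterns and by the conditional
laws [P_S] of [X_S] for the patterns of positive probability.

If these [P_S] are the marginals of a single law [Q] on the full space, then the
product of [Q] with the law of [Omega] makes [X] and [Omega] independent, has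
the same pattern probabilities and the same conditional laws [P_S], and
therefore the same image under [mask] ([compatible_mask_law]). No test
distinguishes this independent law from [P], whatever the sample size.

Conversely, conditioning on [Omega] does not change the law of an independent
[X], so the law of [X] is a witness of compatibility
([independent_compatible]). It follows that not only the two suprema but the
two sets of attained means coincide. *)

Local Open Scope classical_set_scope.
Local Open Scope ring_scope.

Section iid_map.
Context {R : realType} {d1 d2 : measure_display}.
Context {T : measurableType d1} {T' : measurableType d2}.

Lemma measurable_map_tuple n {f : T -> T'} : measurable_fun setT f ->
  measurable_fun setT (fun z : n.-tuple T => map_tuple f z).
Proof.
move=> mf; apply/measurable_fun_tnthP => i.
rewrite (_ : _ \o _ = f \o (fun z : n.-tuple T => tnth z i)).
  by apply: measurableT_comp => //; exact: measurable_tnth.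
by apply: funext => z /=; rewrite tnth_map.
Qed.

(** Sampling commutes with images. [Q] is any law that agrees with the image of
[P] on measurable sets, rather than the image itself: two laws that agree on
measurable sets can still differ as set functions, and the lemma is used for
two different [P] with the same [Q]. By induction on the sample size: the image
of [P \x iid_law P n] under [f] times [map_tuple f] has the values of
[Q \x iid_law Q n] on rectangles, which determine a product measure. *)
Lemma iid_law_map {P : probability T R} {Q : probability T' R} {f : T -> T'} :
  measurable_fun setT f ->
  (forall A, measurable A -> Q A = P (f @^-1` A)) ->
  forall n (C : set (n.-tuple T')), measurable C ->
    iid_law Q n C = iid_law P n (map_tuple f @^-1` C).
Proof.
move=> mf QP; elim=> [|n IH] C mC.
  rewrite /= !diracE; congr ((nat_of_bool _)%:R%:E).
  by apply/idP/idP => /set_mem h; apply/mem_set; move: h;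
    rewrite /preimage /= (tuple0 (map_tuple f [tuple])).
pose g (xz : T * n.-tuple T) := (f xz.1, map_tuple f xz.2).
have mg : measurable_fun setT g.
  apply/measurable_fun_pairP; split.
    exact: measurableT_comp measurable_fst.
  exact: (measurableT_comp (measurable_map_tuple n mf)) measurable_snd.
pose G : {mfun (T * n.-tuple T)%type >-> (T' * n.-tuple T')%type} :=
  HB.pack g (isMeasurableFun.Build _ _ _ _ g mg).
have mC' : measurable (@cons_pair _ T' n @^-1` C).
  by rewrite -[X in measurable X]setTI; exact: measurable_cons_pair.
have prodE A B : measurable A -> measurable B ->
    distribution (P \x iid_law P n)%E G (A `*` B) = (Q A * iid_law Q n B)%E.
  move=> mA mB; rewrite QP// IH// -product_measure1E//.
  - by rewrite -[X in measurable X]setTI; exact: mf.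
  - by rewrite -[X in measurable X]setTI; exact: (measurable_map_tuple n mf).
rewrite [LHS](product_measure_unique prodE)// /distribution /pushforward /=.
congr ((P \x iid_law P n)%E _); apply/seteqP; split=> -[x z] /=;
  by rewrite /G /g /= (_ : cons_pair (f x, map_tuple f z) =
    map_tuple f (cons_pair (x, z)))//; apply: val_inj.
Qed.

End iid_map.

(* Unqualified, the name would denote the selection of a subsequence by a
   sequence of booleans. *)
Local Notation mask := Defs.mask.

Section masking.
Context {R : realType} {d : nat} {disp : 'I_d -> measure_display}.
Context {X : forall j : 'I_d, measurableType (disp j)}.
Implicit Types P : probability (mprod X * cube d)%type R.

(** Both means are the integral of [psi] against the law of [n] independent draws
from the image of [P] under [mask]. *)
Lemma mean_test_mask_law {P P'} n {psi} : tests R X n psi ->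
  (forall A, measurable A -> P (mask @^-1` A) = P' (mask @^-1` A)) ->
  mean_test psi P = mean_test psi P'.
Proof.
move=> [mpsi psi01] PP'.
pose M : {mfun (mprod X * cube d)%type >-> partial_space X} :=
  HB.pack mask (isMeasurableFun.Build _ _ _ _ mask (@measurable_mask _ _ X)).
suff mean_law P1 : (forall A, measurable A ->
    distribution P M A = P1 (mask @^-1` A)) ->
    mean_test psi P1 = (\int[iid_law (distribution P M) n]_z (psi z)%:E)%E.
  by rewrite (mean_law P)// (mean_law P').
move=> PP1; rewrite /mean_test unlock.
have mmap := measurable_map_tuple n (@measurable_mask _ _ X).
rewrite [RHS](eq_measure_integral
  (pushforward (iid_law P1 n) (map_tuple mask))); last first.
  by move=> A mA _; exact: (iid_law_map (@measurable_mask _ _ X) PP1 n).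
rewrite ge0_integral_pushforward//.
- exact/measurable_realfun.measurable_EFinP.
- by move=> z _; rewrite lee_fin; case/andP: (psi01 z).
Qed.

(** The dependent match hands a proof of [j \in S] to the branch that reads the
coordinate [j] of [y], which is indexed by the subtype of members of [S]. *)
Definition fill (S : {set 'I_d}) (y : subspace_prod X S) : partial_space X :=
  fun j => (if j \in S as b return (j \in S = b -> option (X j))
            then fun jS => Some (y (exist _ j jS)) else fun=> None) erefl.

Lemma measurable_fill S : measurable_fun setT (fill S).
Proof.
apply/(measurable_fun_mprodP (T := fun j => option (X j))) => j.
rewrite /fill; move: (erefl (j \in S)).
case: {2 3}(j \in S) => jS; last exact: measurable_cst.
apply: measurableT_comp; first exact: measurable_Some.
exact: (measurable_coord (T := fun j : {j | j \in S} => X (val j))).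
Qed.

(** On the event that the pattern is [S], the masked vector retains nothing of
[x] beyond [x_S]. *)
Lemma mask_fill S (xw : mprod X * cube d) : xw.2 = indic_vec S ->
  mask xw = fill S (restr S xw.1).
Proof.
move=> xwS; apply: functional_extensionality_dep => j.
rewrite /mask xwS /indic_vec /fill; move: (erefl (j \in S)).
by case: {2 3 4}(j \in S).
Qed.

Lemma measurable_restr S : measurable_fun setT (@restr _ _ X S).
Proof.
apply/(measurable_fun_mprodP (T := fun j : {j | j \in S} => X (val j))) => j.
exact: measurable_coord.
Qed.

Lemma measurable_set1_indic S : measurable [set indic_vec S : cube d].
Proof.
rewrite (_ : [set _] = \bigcap_(j in [set: 'I_d])
    (fun w : cube d => w j) @^-1` [set j \in S]).
  apply: fin_bigcap_measurable => // j _.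
  rewrite -[X in measurable X]setTI.
  exact: (measurable_coord (T := fun=> bool : measurableType _)).
apply/seteqP; split=> [w -> //|w h].
by apply: funext => j; exact: h.
Qed.

Lemma measure_pattern_partition P (A : set (mprod X * cube d)) :
  measurable A ->
  P A = (\sum_(S \in [set: {set 'I_d}]) P (A `&` pattern_event S))%E.
Proof.
move=> mA; rewrite -measure_fin_bigcup//.
- rewrite -setI_bigcupr; congr (P _).
  rewrite (_ : \bigcup_i _ = setT) ?setIT//; apply/seteqP; split=> // xw _.
  exists [set j | xw.2 j]%SET => //.
  by apply: funext => j; rewrite /indic_vec inE.
- exact: finite_finset.
- move=> S S' _ _ [xw [[_ hS] [_ hS']]]; apply/setP => j.
  by have /(congr1 (@^~ j)) := etrans (esym hS) hS'.
- move=> S _; apply: measurableI => //; exact: measurable_pattern_event.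
Qed.

Lemma measure_restr_pattern P S (B : set (subspace_prod X S)) : patterns P S ->
  P (restr_fst S @^-1` B `&` pattern_event S) =
  (cond_law P S B * P (pattern_event S))%E.
Proof.
move=> PS; rewrite cond_lawE//.
have Pfin : P (pattern_event S) \is a fin_num.
  by rewrite fin_num_measure//; exact: measurable_pattern_event.
rewrite -muleA -[X in (_ * (_ * X))%E]fineK// -EFinM mulVf ?mule1//.
by rewrite fine_eq0// gt_eqF.
Qed.

(** The law of [X] is the witness: for independent [X] and [Omega], the factor
[P(Omega = 1_S)] cancels in the conditional probability. *)
Lemma independent_compatible : independent_laws R X `<=` compatible_laws R X.
Proof.
move=> P indP.
pose F : {mfun (mprod X * cube d)%type >-> mprod X} :=
  HB.pack fst (isMeasurableFun.Build _ _ _ _ fst measurable_fst).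
exists (distribution P F) => S PS B mB.
rewrite cond_lawE// /pushforward /distribution /=.
have mrB : measurable (restr S @^-1` B).
  rewrite -[X in measurable X]setTI; exact: measurable_restr.
have -> : [set xw : mprod X * cube d | B (restr S xw.1) /\ xw.2 = indic_vec S] =
    (restr S @^-1` B) `*` [set indic_vec S] by [].
rewrite indP//; last exact: measurable_set1_indic.
rewrite -[P (snd @^-1` _)]fineK ?fin_num_measure//; last first.
  exact: measurable_pattern_event.
by rewrite -muleA -EFinM mulfV ?mule1// fine_eq0 ?gt_eqF// fin_num_measure//;
  exact: measurable_pattern_event.
Qed.

(** Resampling [X] from a common extension [Q] of the conditional laws,
independently of [Omega], leaves the law of the masked vector unchanged: the two
laws are compared pattern by pattern, where masking only involves [x_S]. *)
Lemma compatible_mask_law P : compatible_laws R X P ->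
  exists2 P', independent_laws R X P' &
    forall A, measurable A -> P (mask @^-1` A) = P' (mask @^-1` A).
Proof.
case=> Q QP.
pose W : {mfun (mprod X * cube d)%type >-> cube d} :=
  HB.pack snd (isMeasurableFun.Build _ _ _ _ snd measurable_snd).
pose P' : probability (mprod X * cube d)%type R := (Q \x distribution P W)%E.
have P'E A B : measurable A -> measurable B ->
    P' (A `*` B) = (Q A * P (snd @^-1` B))%E.
  by move=> mA mB; rewrite /P' /= product_measure1E.
exists P'.
  move=> A B mA mB; rewrite P'E//.
  (* Write the two marginal events as rectangles, so that both sides are values
     of the product measure. *)
  rewrite -setXT -[in RHS]setTX.
  rewrite !P'E// preimage_setT !probability_setT mule1 mul1e.
  exact: erefl.
move=> A mA.
have mmA : measurable (@mask _ _ X @^-1` A).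
  by rewrite -[X in measurable X]setTI; exact: measurable_mask.
rewrite (measure_pattern_partition P)// (measure_pattern_partition P')//.
apply: eq_fsbigr => S _.
pose B := fill S @^-1` A.
have mB : measurable B.
  by rewrite -[X in measurable X]setTI; exact: measurable_fill.
have -> : mask @^-1` A `&` pattern_event S =
    restr_fst S @^-1` B `&` pattern_event S.
  by apply/seteqP; split=> xw [Axw xwS]; split=> //; move: Axw;
    rewrite /B /preimage /= (mask_fill S xw xwS).
have -> : P' (restr_fst S @^-1` B `&` pattern_event S) =
    (Q (restr S @^-1` B) * P (pattern_event S))%E.
  apply: (P'E (restr S @^-1` B) [set indic_vec S]);
    last exact: measurable_set1_indic.
  rewrite -[X in measurable X]setTI; exact: measurable_restr.
have [PS|] := asboolP (patterns P S).
  by rewrite measure_restr_pattern// -(QP S PS).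
(* A null pattern has no conditional law to compare, but contributes zero to both
   sums. *)
move/negP; rewrite -leNgt => P0.
have {}P0 : P (pattern_event S) = 0%E by apply/eqP; rewrite eq_le P0 /=.
rewrite P0 mule0; apply: subset_measure0 P0.
- apply: measurableI; last exact: measurable_pattern_event.
  by rewrite -[X in measurable X]setTI; exact: measurable_restr_fst.
- exact: measurable_pattern_event.
- exact: subIsetr.
Qed.

End masking.

Theorem proposition1 (R : realType) (d : nat) (disp : 'I_d -> measure_display)
    (X : forall j : 'I_d, measurableTopologicalType (disp j)) :
  independent_laws R X `<=` compatible_laws R X /\
  forall (n : nat) (psi : n.-tuple (partial_space X) -> R),
    tests R X n psi ->
    ereal_sup [set mean_test psi P | P in compatible_laws R X] =
    ereal_sup [set mean_test psi P | P in independent_laws R X].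
Proof.
split=> [|n psi psi_test]; first exact: independent_compatible.
congr ereal_sup; apply/seteqP; split=> _ [P P_law <-].
  have [P' P'_ind PP'] := compatible_mask_law P P_law.
  by exists P' => //; apply/esym/mean_test_mask_law.
by exists P => //; exact: independent_compatible.
Qed.
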